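(* Let $0<p\le\infty$. Equip $\mathcal{L}^p(I)\times\mathcal{L}^p(I)$ with the norm $\|(f,b)\|:=\|f\|_p+\|b\|_p$ if $1\le p\le\infty$, and with the metric $d((f,b),(f',b')):=d_p(f,f')+d_p(b,b')$ if $0<p<1$. Then the fractal convolution operator $\mathcal{P}:\mathcal{L}^p(I)\times\mathcal{L}^p(I)\to\mathcal{L}^p(I)$, $\mathcal{P}(f,b):=f*_T b$, is linear and bounded.
   Context: Let $N\ge 2$, $I=[x_0,x_N]\subset\mathbb{R}$ a nonempty interval and $\Delta: x_0<x_1<\dots<x_N$ a partition of $I$. For $n=1,\dots,N$ let $L_n(x)=a_nx+b_n$ be the affine map with $L_n(x_0)=x_{n-1}$, $L_n(x_N)=x_n$; set $I_1=[x_0,x_1]$ and $I_n=(x_{n-1},x_n]$ for $n=2,\dots,N$. Let $\alpha=(\alpha_1,\dots,\alpha_N)\in(\mathcal{L}^\infty(I))^N$ (scale functions) with $\Lambda:=\operatorname{ess\,sup}\{|\alpha_n(x)|: x\in I,\ n=1,\dots,N\}<1$. For $1\le p\le\infty$, $\mathcal{L}^p(I)$ carries the usual norm $\|\cdot\|_p$; for $0<p<1$ it carries the complete translation-invariant metric $d_p(g,h)=\int_I|g-h|^p\,dx$. For $f,b\in\mathcal{L}^p(I)$ the operator $Tg(x):=f(x)+\alpha_n(L_n^{-1}(x))\,(g-b)(L_n^{-1}(x))$ for $x\in I_n$, $n=1,\dots,N$, is a contraction on $\mathcal{L}^p(I)$ with a unique fixed point, denoted $f*_T b$ and called the fractal convolution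 of the seed function $f$ with the base function $b$. Equivalently, $f*_Tb$ is the unique element of $\mathcal{L}^p(I)$ with $(f*_Tb)(x)=f(x)+\alpha_n(L_n^{-1}(x))\,((f*_Tb)-b)(L_n^{-1}(x))$ for $x\in I_n$, $n=1,\dots,N$. The partition, the maps $L_n$ and $\alpha$ are fixed throughout. *)

(* Defs.v *)
From HB Require Import structures.
From mathcomp Require Import all_boot all_order all_algebra.
From mathcomp Require Import all_classical all_reals all_analysis.
Set Implicit Arguments. Unset Strict Implicit. Unset Printing Implicit Defensive.
Import Order.TTheory GRing.Theory Num.Theory.
Local Open Scope classical_set_scope.
Local Open Scope ring_scope.

(* The partition Delta is given by x : nat -> R, with x 0 < x 1 < ... < x N. *)
Definition Iset (R : realType) (x : nat -> R) (N : nat) : set R :=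
  `[x 0%N, x N]%classic.

Lemma Iset_measurable (R : realType) (x : nat -> R) (N : nat) :
  measurable (Iset x N : set (measurableTypeR R)).
Proof. exact: measurable_itv. Qed.

Definition muI (R : realType) (x : nat -> R) (N : nat)
  : {measure set (measurableTypeR R) -> \bar R} :=
  mrestr (@lebesgue_measure R) (Iset_measurable x N).

(* L_n(y) = a_n y + b_n with L_n(x_0) = x_{n-1}, L_n(x_N) = x_n, i.e.
   a_n = (x_n - x_{n-1}) / (x_N - x_0), b_n = x_{n-1} - a_n x_0. *)
Definition La (R : realType) (x : nat -> R) (N n : nat) : R :=
  (x n - x n.-1) / (x N - x 0%N).
Definition Lb (R : realType) (x : nat -> R) (N n : nat) : R :=
  x n.-1 - La x N n * x 0%N.
Definition Lmap (R : realType) (x : nat -> R) (N n : nat) (y : R) : R :=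
  La x N n * y + Lb x N n.
Definition Linv (R : realType) (x : nat -> R) (N n : nat) (y : R) : R :=
  (y - Lb x N n) / La x N n.

Definition Ipiece (R : realType) (x : nat -> R) (n : nat) : set R :=
  if n == 1%N then `[x 0%N, x 1%N]%classic else `]x n.-1, x n]%classic.

Definition inLp (R : realType) (x : nat -> R) (N : nat) (p : \bar R)
  (g : R -> R) : Prop :=
  measurable_fun (Iset x N) g /\ ('N[muI x N]_p[EFin \o g] < +oo)%E.

Definition dp0 (R : realType) (x : nat -> R) (N : nat) (p : R) (g : R -> R)
  : \bar R := (\int[muI x N]_y (`|g y| `^ p)%:E)%E.

(* the self-referential equation characterizing f *_T b, holding
   almost everywhere on I (elements of L^p are a.e.-classes) *)
Definition fc_eq (R : realType) (x : nat -> R) (N : nat)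
  (alpha : nat -> R -> R) (f b g : R -> R) : Prop :=
  {ae muI x N, forall y, forall n : nat, (1 <= n <= N)%N -> Ipiece x n y ->
     g y = f y + alpha n (Linv x N n y) * (g (Linv x N n y) - b (Linv x N n y))}.

(* the fractal convolution f *_T b: the (a.e.-unique) element of L^p(I)
   satisfying the fixed point equation (a chosen representative) *)
Definition fconv (R : realType) (x : nat -> R) (N : nat) (p : \bar R)
  (alpha : nat -> R -> R) (f b : R -> R) : R -> R :=
  xget (cst 0) [set g | inLp x N p g /\ fc_eq x N alpha f b g].

(* Main.v *)
(* Let phi be the map equal to L_n^-1 on each I_n; since the slopes a_n sum
   to 1, phi preserves Lebesgue measure on I.  With
   u = g - b and v = f - b, the equation of f *_T b reads u = v + A (u o phi)
   where |A| <= Lambda < 1 almost everywhere, and it is solved by the series of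
   the A (A o phi) .. (A o phi^(k-1)) (v o phi^k), which converges almost
   everywhere.  The same invariance of the measure yields uniqueness, as
   u = A (u o phi) gives ||u|| <= Lambda ||u||; linearity follows from
   uniqueness and boundedness from the estimate of the series. *)
Require Import Defs.
From HB Require Import structures.
From mathcomp Require Import all_boot all_order all_algebra.
From mathcomp Require Import all_classical all_reals all_analysis.
From mathcomp Require Import measurable_realfun ess_sup_inf.
From mathcomp Require Import ring lra.
Import Order.TTheory GRing.Theory Num.Theory.
Import numFieldTopology.Exports numFieldNormedType.Exports.
Local Open Scope classical_set_scope.
Local Open Scope ring_scope.

Set Implicit Arguments.
Unset Strict Implicit.
Unset Printing Implicit Defensive.

(** The series is summed pointwise, on a forward invariant set of full measure where a geometric
    series dominates it. This treats exponents below 1 and above 1 alike; sizes are measured by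
    integrals of p-th powers, and roots are taken only at the very end. Two features of the setting
    shape the rest. Functions in L^p(I) are arbitrary off I while [muI] is a measure on the whole
    line, so the data are set to zero off I before [phi] is iterated. And [fconv] is a choice among
    solutions: the existence of one solution gives it its defining properties, and uniqueness
    carries over to it the estimate proved for the sum of the series. *)

Lemma ae_imply d (T : measurableType d) (R : realType)
    (mu : {measure set T -> \bar R}) (P Q : T -> Prop) :
  (forall y, P y -> Q y) -> {ae mu, forall y, P y} -> {ae mu, forall y, Q y}.
Proof. by move=> PQ; apply: filterS. Qed.

Lemma ae_imply2 d (T : measurableType d) (R : realType)
    (mu : {measure set T -> \bar R}) (P Q S : T -> Prop) :
  (forall y, P y -> Q y -> S y) -> {ae mu, forall y, P y} ->
  {ae mu, forall y, Q y} -> {ae mu, forall y, S y}.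
Proof. by move=> PQS; apply: filterS2. Qed.

(** * Comparison of integrals without measurability *)

Section integral_of_nonmeasurable.
Import HBNNSimple.

(* Members of L^p(I) are unconstrained off I, so they need not be measurable on
   the whole line, which carries the measure muI. *)
Lemma ge0_ae_le_integralT d (T : measurableType d) (R : realType)
    (mu : {measure set T -> \bar R}) (f g : T -> \bar R) :
  (forall x, 0 <= f x)%E -> (forall x, 0 <= g x)%E ->
  {ae mu, forall x, (f x <= g x)%E} ->
  (\int[mu]_x f x <= \int[mu]_x g x)%E.
Proof.
move=> f0 g0 [N [mN N0 subN]]; rewrite !ge0_integralTE//.
apply: ge_ereal_sup => _ [h /= hf <-].
(* A simple function [h] below [f], set to zero on the null set [N], keeps its integral and lies
   below [g] everywhere. *)
pose k := proj_nnsfun h (measurableC mN).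
have kE x : k x = h x * \1_(~` N) x by [].
have -> : sintegral mu h = sintegral mu k.
  rewrite -!integralT_nnsfun; apply: ge0_ae_eq_integral => //.
  - exact/measurable_EFinP.
  - exact/measurable_EFinP.
  - by move=> x _; rewrite /= lee_fin.
  - by move=> x _; rewrite /= lee_fin mulr_ge0.
  exists N; split => // x /not_implyP[_]; apply: contra_notP => Nx.
  by rewrite /comp kE indicE mem_set// mulr1.
apply: ereal_sup_ubound; exists k => // x.
rewrite kE indicE; case: (boolP (x \in _)) => [|_]; last by rewrite mulr0.
rewrite inE => Nx; rewrite mulr1; apply: le_trans (hf x) _.
by apply: contrapT => fg; apply: Nx; exact: subN.
Qed.

End integral_of_nonmeasurable.

Lemma ge0_ae_eq_integralT d (T : measurableType d) (R : realType)
    (mu : {measure set T -> \bar R}) (f g : T -> \bar R) :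
  (forall x, 0 <= f x)%E -> (forall x, 0 <= g x)%E ->
  {ae mu, forall x, f x = g x} ->
  (\int[mu]_x f x = \int[mu]_x g x)%E.
Proof.
move=> f0 g0 fg; apply/eqP; rewrite eq_le.
by apply/andP; split; apply: ge0_ae_le_integralT => //;
  apply: filterS fg => x ->.
Qed.

Lemma measurable_iter d (T : measurableType d) (phi : T -> T) n :
  measurable_fun setT phi -> measurable_fun setT (iter n phi).
Proof.
by move=> mphi; elim: n => [|n ih]; [exact: measurable_id|exact: measurableT_comp].
Qed.

(** * Pointwise solution of u = v + A (u o phi) *)

Section weighted_composition.
Context d (T : measurableType d) (R : realType).
Variables (phi : T -> T) (A : T -> R) (Lam : R).
Hypotheses (mphi : measurable_fun setT phi) (mA : measurable_fun setT A).
Hypothesis ALam : forall y, `|A y| <= Lam.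

(** The k-th power of the operator u |-> A (u o phi), applied to [v]: the k-th term of its Neumann
    series. *)
Definition cocycle_term (v : T -> R) (y : T) (k : nat) : R :=
  (\prod_(j < k) A (iter j phi y)) * v (iter k phi y).

Lemma cocycle_term0 v y : cocycle_term v y 0 = v y.
Proof. by rewrite /cocycle_term big_ord0 mul1r. Qed.

Lemma cocycle_termS v y k :
  cocycle_term v y k.+1 = A y * cocycle_term v (phi y) k.
Proof.
rewrite /cocycle_term big_ord_recl /= -mulrA; congr (_ * (_ * v _)).
  by apply: eq_bigr => j _; rewrite -iterSr.
by rewrite -iterSr.
Qed.

Lemma cocycle_term_le v y k :
  `|cocycle_term v y k| <= Lam ^+ k * `|v (iter k phi y)|.
Proof.
rewrite normrM ler_wpM2r// normr_prod.
elim: k => [|k ih]; first by rewrite big_ord0.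
by rewrite big_ord_recr /= exprSr ler_pM// prodr_ge0.
Qed.

Lemma measurable_cocycle_term v k :
  measurable_fun setT v -> measurable_fun setT (cocycle_term v ^~ k).
Proof.
move=> mv; apply: measurable_funM.
  apply: measurable_prod => j _.
  exact: (measurableT_comp mA (measurable_iter j mphi)).
exact: (measurableT_comp mv (measurable_iter k mphi)).
Qed.

(* The solution is u = sum_k A (A o phi) .. (A o phi^(k-1)) (v o phi^k). *)
Lemma cocycle_solution (v D : T -> R) (G : set T) (lam : R) :
  measurable_fun setT v -> measurable G -> (forall y, G y -> G (phi y)) ->
  0 <= lam < 1 ->
  (forall y k, G y -> Lam ^+ k * `|v (iter k phi y)| <= D y * lam ^+ k) ->
  exists u : T -> R, measurable_fun setT u /\
    forall y, G y -> u y = v y + A y * u (phi y) /\ `|u y| <= D y / (1 - lam).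
Proof.
move=> mv mG Gphi /andP[lam0 lam1] vD.
have nlam : `|lam| < 1 by rewrite ger0_norm.
have tD y k : G y -> `|cocycle_term v y k| <= geometric (D y) lam k.
  by move=> Gy; exact: le_trans (cocycle_term_le _ _ _) (vD _ _ Gy).
have cnt y : G y -> cvgn [normed series (cocycle_term v y)].
  move=> Gy; apply: (series_le_cvg _ _ _ (is_cvg_geometric_series (a := D y) nlam)).
  - by move=> n; exact: normr_ge0.
  - by move=> n; exact: le_trans (normr_ge0 _) (tD y n Gy).
  - by move=> n; exact: tD.
have ct y : G y -> cvgn (series (cocycle_term v y)).
  by move=> Gy; exact: normed_cvg (cnt y Gy).
(* The indicator makes the partial sums converge everywhere, so that their limit is measurable; on
   [G] nothing changes. *)
pose s n y := \1_G y * series (cocycle_term v y) n.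
pose u y := limn (s ^~ y).
have cs y : cvgn (s ^~ y).
  rewrite /s; case: (pselect (G y)) => Gy.
    by apply: is_cvgM; [exact: is_cvg_cst|exact: ct].
  rewrite (_ : (fun _ => _) = cst 0); first exact: is_cvg_cst.
  by apply/funext => n; rewrite indicE memNset// mul0r.
have uE y : G y -> u y = limn (series (cocycle_term v y)).
  move=> Gy; rewrite /u (_ : s ^~ y = series (cocycle_term v y))//.
  by apply/funext => n; rewrite /s indicE mem_set// mul1r.
exists u; split.
  apply: (@measurable_fun_cvg _ _ _ _ s); last by move=> y _; exact: cs.
  move=> n; apply: measurable_funM; first exact: measurable_indic.
  by apply: measurable_sum => k; exact: measurable_cocycle_term.
move=> y Gy; rewrite !uE//; last exact: Gphi.
split; last first.
  apply: le_trans (lim_series_norm (cnt y Gy)) _.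
  rewrite -(cvg_lim _ (cvg_geometric_series (a := D y) nlam))//.
  apply: lim_series_le => //; first exact: cnt.
    exact: is_cvg_geometric_series.
  by move=> n; exact: tD.
(* The partial sum of order n+1 at [y] is [v y] plus [A y] times the partial sum of order n at
   [phi y]; the equation is the limit of this identity. *)
apply: cvg_lim => //; rewrite -cvg_shiftS.
have -> : [sequence series (cocycle_term v y) n.+1]_n =
    (fun n => v y + A y * series (cocycle_term v (phi y)) n).
  apply/funext => n; rewrite /series /= !big_mkord big_ord_recl cocycle_term0.
  by rewrite mulr_sumr; congr (_ + _); apply: eq_bigr => j _; rewrite -cocycle_termS.
apply: cvgD; first exact: cvg_cst.
by apply: cvgM; [exact: cvg_cst|exact: ct (Gphi _ Gy)].
Qed.

End weighted_composition.

Lemma powR_lt1 (R : realType) (a p : R) : 0 <= a -> a < 1 -> 0 < p -> a `^ p < 1.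
Proof.
move=> a0 a1 p0; have := gt0_ltr_powR p0 (x := a) (y := 1).
by rewrite powR1; apply; rewrite ?nnegrE.
Qed.

(** * Estimates under a measure-preserving map *)

Section preserved_measure.
Context d (T : measurableType d) (R : realType).
Variables (mu : {measure set T -> \bar R}) (phi : T -> T).
Hypothesis mphi : measurable_fun setT phi.
Hypothesis mu_phi : forall B, measurable B -> mu (phi @^-1` B) = mu B.

Lemma ae_preimage (P : T -> Prop) :
  {ae mu, forall y, P y} -> {ae mu, forall y, P (phi y)}.
Proof.
move=> [N [mN N0 subN]]; exists (phi @^-1` N); split.
- by rewrite -[_ @^-1` _]setTI; exact: mphi.
- by rewrite [LHS]mu_phi.
- by move=> y /= Py; exact: subN.
Qed.

Lemma ge0_integral_comp (F : T -> \bar R) :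
  measurable_fun setT F -> (forall y, 0 <= F y)%E ->
  (\int[mu]_y F (phi y) = \int[mu]_y F y)%E.
Proof.
move=> mF F0; transitivity (\int[pushforward mu phi]_y F y)%E.
  by rewrite ge0_integral_pushforward.
by apply: eq_measure_integral => B mB _; exact: mu_phi.
Qed.

Lemma ge0_integral_comp_iter (F : T -> \bar R) k :
  measurable_fun setT F -> (forall y, 0 <= F y)%E ->
  (\int[mu]_y F (iter k phi y) = \int[mu]_y F y)%E.
Proof.
move=> mF F0; elim: k => [//|k <-].
rewrite -(ge0_integral_comp (F := fun y => F (iter k phi y)))//.
  by apply: eq_integral => y _; rewrite iterSr.
exact: (measurableT_comp mF (measurable_iter k mphi)).
Qed.

Lemma measurable_norm_powR (f : T -> R) (p : R) :
  measurable_fun setT f -> measurable_fun setT (fun y => (`|f y| `^ p)%:E).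
Proof.
move=> mf; apply/measurable_EFinP.
apply: (measurableT_comp (measurable_powR p)).
exact: measurableT_comp.
Qed.

Variables (A : T -> R) (Lam : R).
Hypotheses (mA : measurable_fun setT A) (ALam : forall y, `|A y| <= Lam).
Hypotheses (Lam0 : 0 < Lam) (Lam1 : Lam < 1).

(** Phrased with the integral J of |g|^p, so that exponents below 1 are covered too. Finiteness of J
    is what turns J <= Lam^p J into J = 0. *)
Lemma weighted_composition_fixed_eq0 (p : R) (g : T -> R) :
  0 < p -> measurable_fun setT g ->
  {ae mu, forall y, g y = A y * g (phi y)} ->
  (\int[mu]_y (`|g y| `^ p)%:E < +oo)%E ->
  {ae mu, forall y, g y = 0}.
Proof.
move=> p0 mg gE goo; have mgp := measurable_norm_powR p mg.
set J := (\int[mu]_y (`|g y| `^ p)%:E)%E in goo.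
have J0 : (0 <= J)%E by apply: integral_ge0 => y _; rewrite lee_fin powR_ge0.
have Jc : (J <= (Lam `^ p)%:E * J)%E.
  rewrite {2}/J -(ge0_integral_comp mgp); last by move=> y; rewrite lee_fin powR_ge0.
  rewrite -ge0_integralZl//; last 2 first.
  - exact: (measurableT_comp mgp mphi).
  - by rewrite lee_fin powR_ge0.
  apply: ge0_ae_le_integralT => [y|y|]; rewrite -?EFinM ?lee_fin ?powR_ge0//.
    by rewrite mulr_ge0 ?powR_ge0.
  apply: filterS gE => y gy; rewrite -EFinM lee_fin -powRM ?(ltW Lam0)//.
  apply: ge0_ler_powR; rewrite ?nnegrE ?mulr_ge0 ?(ltW p0) ?(ltW Lam0)//.
  by rewrite {1}gy normrM ler_wpM2r.
have J_eq0 : J = 0%E.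
  have Lp : Lam `^ p < 1 by apply: powR_lt1 => //; exact: ltW.
  move: Jc J0 goo; case: J => [j| |]//; rewrite -EFinM !lee_fin => jj j0 _.
  by congr EFin; apply/eqP; rewrite eq_le j0 andbT; nra.
have : (\int[mu]_y `|(`|g y| `^ p)%:E| = 0)%E.
  rewrite -J_eq0; apply: eq_integral => y _.
  by rewrite gee0_abs// lee_fin powR_ge0.
move/(ae_eq_integral_abs mu measurableT mgp); apply: filterS => y /(_ I) [].
by move/powR_eq0_eq0/normr0_eq0.
Qed.

Lemma weighted_composition_solution_bounded (v : T -> R) (M : R) :
  measurable_fun setT v -> {ae mu, forall y, `|v y| <= M} ->
  exists u : T -> R, [/\ measurable_fun setT u,
    {ae mu, forall y, u y = v y + A y * u (phi y)} &
    {ae mu, forall y, `|u y| <= M / (1 - Lam)}].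
Proof.
(* The series at [y] sees [v] along the whole orbit of [y], so the bound is required at every
   iterate. This set is forward invariant, and of full measure because each iterate pulls null sets
   back to null sets. *)
move=> mv vM; pose G := [set y | forall k, `|v (iter k phi y)| <= M].
have mG : measurable G.
  rewrite (_ : G = \bigcap_k [set y | `|v (iter k phi y)| <= M]); last first.
    by apply/seteqP; split => [y Gy k _|y Gy k]; exact: Gy.
  apply: bigcapT_measurable => k; rewrite -[X in measurable X]setTI.
  apply: (@measurable_fun_le _ _ _ setT _ (cst M)) => //.
  apply: measurableT_comp => //.
  exact: (measurableT_comp mv (measurable_iter k mphi)).
have Gphi y : G y -> G (phi y) by move=> Gy k; rewrite -iterSr; exact: Gy.
have aeG : {ae mu, forall y, G y}.
  apply: ae_foralln; elim=> [//|k /ae_preimage].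
  by apply: filterS => y; rewrite -iterSr.
have [| |u [mu_ uG]] := cocycle_solution mphi mA ALam (D := cst M) mv mG Gphi (lam := Lam).
- by rewrite (ltW Lam0).
- by move=> y k Gy; rewrite mulrC ler_wpM2r// exprn_ge0// ltW.
by exists u; split => //; apply: filterS aeG => y /uG[].
Qed.

(* W = sum_k m^k |v o phi^k|^p has integral ||v||_p^p / (1 - m), and on
   {W < oo} the k-th term of the series of u is at most lam^k W^(1/p), where
   m = (Lam/lam)^p < 1; this covers p < 1 and p >= 1 alike. *)
Lemma weighted_composition_solution_power (p : R) : 0 < p ->
  exists2 K : R, 0 <= K & forall v : T -> R, measurable_fun setT v ->
    (\int[mu]_y (`|v y| `^ p)%:E < +oo)%E ->
    exists u : T -> R, [/\ measurable_fun setT u,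
      {ae mu, forall y, u y = v y + A y * u (phi y)} &
      (\int[mu]_y (`|u y| `^ p)%:E <= K%:E * \int[mu]_y (`|v y| `^ p)%:E)%E].
Proof.
move=> p0; pose lam := (Lam + 1) / 2.
have [Llam lam1] : Lam < lam /\ lam < 1 by have [] := midf_lt Lam1.
have lam0 : 0 < lam := lt_trans Lam0 Llam.
have p'0 : p != 0 by rewrite gt_eqF.
pose m := (Lam / lam) `^ p.
have Ll0 : 0 <= Lam / lam by rewrite divr_ge0// ltW.
have m0 : 0 < m by rewrite powR_gt0// divr_gt0.
have m1 : m < 1.
  by apply: powR_lt1 => //; rewrite ltr_pdivrMr// mul1r.
(* The first factor is the p-th power of the constant in |u| <= W^(1/p) / (1 - lam), the second
   comes from the integral of [W]. *)
exists (((1 - lam)^-1) `^ p * (1 - m)^-1).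
  by rewrite mulr_ge0 ?powR_ge0// invr_ge0 subr_ge0 ltW.
move=> v mv voo; set J := (\int[mu]_y _)%E in voo *.
have mvp := measurable_norm_powR p mv.
pose w k y := (m ^+ k * `|v (iter k phi y)| `^ p)%:E.
have w0 k y : (0 <= w k y)%E by rewrite lee_fin mulr_ge0 ?exprn_ge0 ?powR_ge0// ltW.
have mw k : measurable_fun setT (w k).
  apply/measurable_EFinP/measurable_funM => //; apply/measurable_EFinP.
  exact: (measurableT_comp mvp (measurable_iter k mphi)).
pose W y := (\sum_(k <oo) w k y)%E.
have W0 y : (0 <= W y)%E by apply: nneseries_ge0.
have mW : measurable_fun setT W by exact: ge0_emeasurable_sum.
have iwE k : (\int[mu]_y w k y = (m ^+ k)%:E * J)%E.
  have <- : (\int[mu]_y (`|v (iter k phi y)| `^ p)%:E = J)%E.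
    by apply: (ge0_integral_comp_iter k mvp) => y; rewrite lee_fin powR_ge0.
  rewrite -ge0_integralZl//.
  - exact: (measurableT_comp mvp (measurable_iter k mphi)).
  - by rewrite lee_fin exprn_ge0// ltW.
have J0 : (0 <= J)%E by apply: integral_ge0 => y _; rewrite lee_fin powR_ge0.
have Jfin : J \is a fin_num by rewrite ge0_fin_numE.
have iWE : (\int[mu]_y W y = ((1 - m)^-1)%:E * J)%E.
  rewrite integral_nneseries//.
  rewrite (eq_eseriesr (g := fun k => (geometric (fine J) m k)%:E)); last first.
    by move=> k _; rewrite iwE -[in LHS](fineK Jfin) -EFinM mulrC.
  rewrite -[in RHS](fineK Jfin) -EFinM mulrC.
  apply/cvg_lim => //; apply: cvg_EFin => //.
    by apply: nearW => n; rewrite sumEFin.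
  rewrite [X in X @ _ --> _](_ : _ = series (geometric (fine J) m)).
    by apply: cvg_geometric_series; rewrite ger0_norm ?(ltW m0).
  by apply/funext => n; rewrite /= sumEFin.
(* Since [m > 0], this recursion shows that [W (phi y)] is finite wherever [W y] is: the finiteness
   set is forward invariant. *)
have WS y : W y = ((`|v y| `^ p)%:E + m%:E * W (phi y))%E.
  rewrite /W nneseries_recl// {1}/w expr0 mul1r; congr (_ + _)%E.
  rewrite -nneseriesZl// -nneseries_addn//; apply: eq_eseriesr => k _.
  by rewrite /w addn1 -EFinM mulrA -exprS iterSr.
pose G := [set y | W y \is a fin_num].
have mG : measurable G by rewrite -[G]setTI; exact: emeasurable_fin_num.
have aeG : {ae mu, forall y, G y}.
  have : mu.-integrable setT W.
    apply/integrableP; split => //.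
    under eq_integral do rewrite gee0_abs//.
    by rewrite iWE -(fineK Jfin) -EFinM ltry.
  by move/(integrable_ae measurableT); apply: filterS => y; exact.
have Gphi y : G y -> G (phi y).
  rewrite /G /= WS => h; rewrite ge0_fin_numE//.
  move: h; rewrite ltNge leye_eq; apply: contraTN => /eqP ->.
  by rewrite gt0_muley ?lte_fin.
have bnd y k : G y ->
    Lam ^+ k * `|v (iter k phi y)| <= fine (W y) `^ p^-1 * lam ^+ k.
  move=> Gy; have wW : m ^+ k * `|v (iter k phi y)| `^ p <= fine (W y).
    rewrite -lee_fin fineK//.
    apply: le_trans (nneseries_lim_ge (m := 0%N) k.+1 _) => //.
    by rewrite big_nat_recr//= leeDr// sume_ge0.
  rewrite -ler_pdivrMr ?exprn_gt0// mulrAC -expr_div_n.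
  rewrite -[leLHS](@powRr1 R) ?mulr_ge0 ?exprn_ge0//.
  rewrite -(divff p'0) powRrM; apply: ge0_ler_powR.
  - by rewrite invr_ge0 ltW.
  - by rewrite nnegrE powR_ge0.
  - by rewrite nnegrE fine_ge0.
  rewrite powRM ?exprn_ge0//; apply: le_trans wW.
  suff -> : ((Lam / lam) ^+ k) `^ p = m ^+ k by [].
  by rewrite /m -!powR_mulrn ?powR_ge0// -!powRrM [p * _]mulrC.
have [|u [mu_ uG]] := cocycle_solution mphi mA ALam mv mG Gphi (lam := lam) _ bnd.
  by rewrite (ltW lam0).
exists u; split => //; first by apply: filterS aeG => y /uG[].
rewrite EFinM -muleA -iWE -ge0_integralZl//; last by rewrite lee_fin powR_ge0.
apply: ge0_ae_le_integralT => [y|y|].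
- by rewrite lee_fin powR_ge0.
- by rewrite mule_ge0// lee_fin powR_ge0.
apply: filterS aeG => y Gy; have [_ uy] := uG y Gy.
rewrite -(fineK Gy) -EFinM lee_fin.
have fW0 : 0 <= fine (W y) by exact: fine_ge0.
have WE : fine (W y) = (fine (W y) `^ p^-1) `^ p.
  by rewrite -powRrM mulVf// powRr1.
rewrite [in leRHS]WE -powRM ?powR_ge0 ?invr_ge0 ?subr_ge0 ?(ltW lam1)//.
apply: ge0_ler_powR; rewrite ?nnegrE ?(ltW p0)//; last by rewrite mulrC.
by rewrite mulr_ge0 ?powR_ge0// invr_ge0 subr_ge0 ltW.
Qed.

End preserved_measure.

(** * The piecewise affine map phi and its invariant measure *)

Section partition_shift.
Context (R : realType) (N : nat) (x : nat -> R).
Hypothesis N0 : (0 < N)%N.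
Hypothesis xS : forall k : nat, (k < N)%N -> x k < x k.+1.

Local Notation leb := (@lebesgue_measure R).
Local Notation I := (Iset x N).

(** The pushforward divided by [a] agrees with Lebesgue measure on half-open intervals, and these
    determine the measure. *)
Lemma lebesgue_measure_affine_preimage (a b : R) (B : set (measurableTypeR R)) :
  0 < a -> measurable B ->
  (leb ((fun y : R => (y - b) / a)%R @^-1` B) = a%:E * leb B)%E.
Proof.
move=> a0 mB; pose f : measurableTypeR R -> measurableTypeR R := fun y : R => ((y - b) / a)%R.
have mf : measurable_fun setT f.
  by apply: measurable_funM => //; exact: measurable_funB.
have a'0 : 0 <= a^-1 by rewrite invr_ge0 ltW.
pose m := mscale (NngNum a'0) (pushforward leb f).
suff -> : (leb B = a^-1%:E * leb (f @^-1` B))%E.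
  by rewrite muleA -EFinM divff ?gt_eqF// mul1e.
suff muE X : ocitv X -> leb X = m mf X by rewrite (lebesgue_measure_unique muE).
case=> -[c d] _ <- /=.
rewrite /m /mscale /= /pushforward /=.
have -> : f @^-1` [set` `]c, d]] = `]a * c + b, a * d + b]%classic.
  apply/seteqP; split => y; rewrite /f /= !in_itv /=.
    by rewrite ltr_pdivlMr// ler_pdivrMr// ltrBrDr lerBlDr ![_ * a]mulrC.
  by rewrite ltr_pdivlMr// ler_pdivrMr// ltrBrDr lerBlDr ![_ * a]mulrC.
rewrite !lebesgue_measure_itv /= !lte_fin ltrD2r ltr_pM2l//.
case: ifPn => _; last by rewrite mule0.
rewrite -!EFinD -EFinM; congr EFin.
by field; rewrite gt_eqF.
Qed.

Lemma partition_lt i j : (i < j <= N)%N -> x i < x j.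
Proof.
move=> /andP[]; elim: j => [//|j ih]; rewrite ltnS leq_eqVlt => /orP[/eqP ->|ij] jN.
  exact: xS.
exact: lt_trans (ih ij (ltnW jN)) (xS jN).
Qed.

Lemma partition_le i j : (i <= j <= N)%N -> x i <= x j.
Proof.
move=> /andP[]; rewrite leq_eqVlt => /orP[/eqP -> //|ij jN].
by apply/ltW/partition_lt; rewrite ij.
Qed.

Lemma La_gt0 n : (n < N)%N -> 0 < La x N n.+1.
Proof.
move=> nN; rewrite /La divr_gt0// subr_gt0; first exact: xS.
by apply: partition_lt; rewrite N0 leqnn.
Qed.

Lemma LinvE n y : (n < N)%N ->
  Linv x N n.+1 y = x 0%N + (y - x n) * (x N - x 0%N) / (x n.+1 - x n).
Proof.
move=> nN; rewrite /Linv /Lb /La /=; field.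
have ? := xS nN; have ? : x 0%N < x N by apply: partition_lt; rewrite N0 leqnn.
by rewrite !subr_eq0 !gt_eqF.
Qed.

Lemma Linv_in n y : (n < N)%N ->
  (x 0%N < Linv x N n.+1 y <= x N) = (x n < y <= x n.+1).
Proof.
move=> nN; have := xS nN; rewrite -subr_gt0 => d0.
have : 0 < x N - x 0%N by rewrite subr_gt0 partition_lt// N0 leqnn.
move=> D0; rewrite LinvE// -[leRHS](subrKC (x 0%N)) lerD2l.
rewrite ltrDl pmulr_lgt0 ?invr_gt0// pmulr_lgt0// subr_gt0.
by rewrite ler_pdivrMr// mulrC ler_pM2l// lerD2r.
Qed.

Lemma Linv_left n : (n < N)%N -> Linv x N n.+1 (x n) = x 0%N.
Proof. by move=> nN; rewrite LinvE// subrr !mul0r addr0. Qed.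

(** Only the first piece contains its left end. This exceptional point [x 0] is fixed by the inverse
    branch of that piece. *)
Lemma Ipiece_itv n y : (n < N)%N -> Ipiece x n.+1 y ->
  (x n < y <= x n.+1) \/ n = 0%N /\ y = x 0%N.
Proof.
rewrite /Ipiece; case: n => [|n] nN /=; rewrite in_itv /=; last by left.
move=> /andP[]; rewrite le_eqVlt => /orP[/eqP ->|-> ->]; last by left.
by right.
Qed.

Lemma itv_Ipiece n y : (x n < y <= x n.+1) -> Ipiece x n.+1 y.
Proof.
rewrite /Ipiece; case: n => [|n] /= h; rewrite in_itv //=.
by case/andP: h => /ltW -> ->.
Qed.

Lemma Ipiece_sub n y : (n < N)%N -> Ipiece x n.+1 y -> I y.
Proof.
move=> nN /(Ipiece_itv nN); rewrite /Iset /= in_itv /=.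
case=> [/andP[ny yn]|[_ ->]]; last by rewrite lexx partition_le// leqnn.
rewrite (le_trans (partition_le _) (ltW ny)) ?leq0n ?(ltnW nN)//=.
by rewrite (le_trans yn)// partition_le// nN leqnn.
Qed.

Lemma Ipiece_inj m n y : (m < N)%N -> (n < N)%N ->
  Ipiece x m.+1 y -> Ipiece x n.+1 y -> m = n.
Proof.
wlog mn : m n / (m <= n)%N.
  move=> h mN nN ym yn; case: (leqP m n) => [mn|/ltnW nm]; first exact: h.
  by apply/esym; exact: h.
move=> mN nN ym yn; apply/eqP; rewrite eqn_leq mn /= leqNgt; apply/negP => ltmn.
have ny : x n < y.
  by case: (Ipiece_itv nN yn) => [/andP[]//|[n0]]; rewrite n0 in ltmn.
have : y <= x m.+1.
  case: (Ipiece_itv mN ym) => [/andP[]//|[-> ->]].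
  by apply: partition_le; rewrite leq0n.
apply/negP; rewrite -ltNge; apply: le_lt_trans ny.
by apply: partition_le; rewrite ltmn ltnW.
Qed.

Lemma partition_cover k y : (k <= N)%N -> x 0%N < y <= x k ->
  exists2 n, (n < k)%N & x n < y <= x n.+1.
Proof.
elim: k => [|k ih] kN /andP[y0 yk]; first by rewrite ltNge yk in y0.
case: (leP y (x k)) => [yk'|ky]; last by exists k => //; rewrite ky.
have [|n nk ny] := ih (ltnW kN); first by rewrite y0.
by exists n => //; exact: ltnW.
Qed.

Lemma Iset_Ipiece y : I y -> exists2 n, (n < N)%N & Ipiece x n.+1 y.
Proof.
rewrite /Iset /= in_itv /= => /andP[]; rewrite le_eqVlt => /orP[/eqP <- _|y0 yN].
  exists 0%N => //; rewrite /Ipiece /= in_itv /= lexx /=.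
  exact: ltW (xS N0).
have [|n nN ny] := partition_cover (leqnn N) (y := y); first by rewrite y0.
by exists n => //; exact: itv_Ipiece.
Qed.

(** As a sum over indicators, its measurability is that of each affine branch. Off I, a [muI]-null
    set, the value is 0. *)
Definition partition_shift (y : R) : R :=
  \sum_(n < N) \1_(Ipiece x n.+1) y * Linv x N n.+1 y.

Lemma sum_IpieceE (F : nat -> R) n y : (n < N)%N -> Ipiece x n.+1 y ->
  \sum_(i < N) \1_(Ipiece x i.+1) y * F i = F n.
Proof.
move=> nN yn; rewrite (bigD1 (Ordinal nN)) //= big1 ?addr0.
  by rewrite indicE mem_set// mul1r.
move=> i ni; rewrite indicE memNset ?mul0r// => yi.
by move/eqP: ni; apply; apply: val_inj; exact: Ipiece_inj yi yn.
Qed.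

Lemma partition_shiftE n y : (n < N)%N -> Ipiece x n.+1 y ->
  partition_shift y = Linv x N n.+1 y.
Proof. exact: (sum_IpieceE (fun n => Linv x N n.+1 y)). Qed.

Lemma measurable_Ipiece n : measurable (Ipiece x n : set R).
Proof. by rewrite /Ipiece; case: ifP => _; exact: measurable_itv. Qed.

Lemma measurable_partition_shift : measurable_fun (setT : set (measurableTypeR R))
  (partition_shift : measurableTypeR R -> measurableTypeR R).
Proof.
suff : measurable_fun (setT : set R) partition_shift by [].
apply: measurable_sum => n; apply: measurable_funM.
  exact: (@measurable_indic _ _ R setT _ (measurable_Ipiece n.+1)).
by rewrite /Linv; apply: measurable_funM => //; exact: measurable_funB.
Qed.

Lemma partition_shift_I y : I y -> I (partition_shift y).
Proof.
move=> /Iset_Ipiece[n nN yn]; rewrite (partition_shiftE nN yn) /Iset /= in_itv /=.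
case: (Ipiece_itv nN yn) => [|[n0 ->]]; first by rewrite -Linv_in// => /andP[/ltW -> ->].
by rewrite n0 Linv_left// lexx partition_le ?leqnn.
Qed.

(** The first [k] pieces are taken to allow induction. On each half-open piece the preimage of [B]
    is the affine preimage of [B] within []x 0, x N]], and the slopes telescope to a factor that
    equals 1 at [k = N]. *)
Lemma lebesgue_measure_partition_shift (B : set (measurableTypeR R)) k :
  measurable B -> (k <= N)%N ->
  (leb (partition_shift @^-1` B `&` `]x 0%N, x k]%classic) =
   ((x k - x 0%N) / (x N - x 0%N))%:E * leb (B `&` `]x 0%N, x N]%classic))%E.
Proof.
move=> mB; have mpre : measurable (partition_shift @^-1` B : set (measurableTypeR R)).
  by rewrite -[_ @^-1` _]setTI; exact: measurable_partition_shift.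
elim: k => [|k ih] kN.
  by rewrite subrr mul0r mul0e set_itvoc0 setI0 measure0.
have -> : `]x 0%N, x k.+1]%classic = `]x 0%N, x k]%classic `|` `]x k, x k.+1]%classic.
  have x0k : x 0%N <= x k by apply: partition_le; rewrite leq0n ltnW.
  by rewrite (itv_bndbnd_setU (x := BRight (x k)))// bnd_simp// ltW// xS.
rewrite setIUr measureU; last 3 first.
- by apply: measurableI => //; exact: measurable_itv.
- by apply: measurableI => //; exact: measurable_itv.
- apply/seteqP; split => // y [[_ /=]]; rewrite !in_itv /= => /andP[_ yk] [_].
  by rewrite ltNge yk.
rewrite [X in (X + _)%E](ih (ltnW kN)).
have -> : partition_shift @^-1` B `&` `]x k, x k.+1]%classic =
    Linv x N k.+1 @^-1` (B `&` `]x 0%N, x N]%classic).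
  apply/seteqP; split => y /=; rewrite !in_itv /= Linv_in//.
    by move=> [+ yk]; rewrite (partition_shiftE kN (itv_Ipiece yk)).
  by move=> [+ yk]; rewrite (partition_shiftE kN (itv_Ipiece yk)).
have mBJ : measurable (B `&` `]x 0%N, x N]%classic : set (measurableTypeR R)).
  by apply: measurableI => //; exact: measurable_itv.
rewrite [X in (_ + X)%E](lebesgue_measure_affine_preimage _ (La_gt0 kN) mBJ).
rewrite -ge0_muleDl; last 2 first.
- by rewrite lee_fin divr_ge0// subr_ge0 partition_le// leq0n ?leqnn// (ltnW kN).
- by rewrite lee_fin ltW// La_gt0.
congr (_ * _)%E; rewrite -EFinD /La /= -mulrDl; congr (_ / _)%:E.
by rewrite addrC addrA subrK.
Qed.

Lemma muI_itv (B : set (measurableTypeR R)) : measurable B ->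
  muI x N B = leb (B `&` `]x 0%N, x N]%classic).
Proof.
move=> mB; rewrite /muI /= /mrestr /Iset.
have x0N : x 0%N <= x N by apply: partition_le; rewrite leq0n leqnn.
have B0 : leb (B `&` [set x 0%N]) = 0%E.
  apply/eqP; rewrite eq_le measure_ge0 andbT -(lebesgue_measure_set1 (x 0%N)).
  by apply: le_measure; rewrite ?inE//; exact: measurableI.
rewrite -(setU1itv false) ?bnd_simp// setIUr measureU.
- by rewrite [X in (X + _)%E]B0 add0e.
- exact: measurableI.
- by apply: measurableI => //; exact: measurable_itv.
- apply/seteqP; split => // y [[_ /= ->] [_]] /=.
  by rewrite in_itv /= ltxx.
Qed.

Lemma muI_partition_shift (B : set (measurableTypeR R)) : measurable B ->
  muI x N (partition_shift @^-1` B) = muI x N B.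
Proof.
move=> mB; rewrite !muI_itv//; last first.
  by rewrite -[_ @^-1` _]setTI; exact: measurable_partition_shift.
rewrite lebesgue_measure_partition_shift// divff ?mul1e//.
by rewrite subr_eq0 gt_eqF// partition_lt// N0 leqnn.
Qed.

Lemma ae_muI_Iset : {ae muI x N, forall y, I y}.
Proof.
exists (~` I); split => //.
- by apply: measurableC; exact: Iset_measurable.
- by rewrite /muI /= /mrestr setICl measure0.
Qed.

End partition_shift.

(** * A common measure of size for all exponents *)

Section Lp_gauge.
Context d (T : measurableType d) (R : realType).
Variable mu : {measure set T -> \bar R}.

(* Homogeneous of degree r for finite exponents r, so that it is the d_p of
   the case p < 1 and the p-th power of the norm otherwise. *)
Definition Lgauge (p : \bar R) (f : T -> R) : \bar R :=
  if p is r%:E then (\int[mu]_y (`|f y| `^ r)%:E)%E else ('N[mu]_p[EFin \o f])%E.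

Lemma Lgauge_ge0 p f : (0 <= Lgauge p f)%E.
Proof.
case: p => [r| |] /=; [|exact: Lnorm_ge0|exact: Lnorm_ge0].
by apply: integral_ge0 => y _; rewrite lee_fin powR_ge0.
Qed.

Lemma Lnorm_fin_gauge r f :
  ('N[mu]_(r%:E)[EFin \o f] = (Lgauge r%:E f) `^ r^-1)%E.
Proof. by rewrite unlock. Qed.

Lemma Lnormy_le f (M : R) : 0 <= M ->
  ('N[mu]_+oo[EFin \o f] <= M%:E)%E <-> {ae mu, forall y, `|f y| <= M}.
Proof.
move=> M0; rewrite unlock; case: ifPn => [_|].
  split => [/ess_supP|fM]; first by apply: filterS => y; rewrite /= lee_fin.
  by apply/ess_supP; apply: filterS fM => y; rewrite /= lee_fin.
(* The essential supremum norm is 0 by convention on a null space, where every property holds almost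
   everywhere. *)
rewrite -leNgt => muT; split => _; last by rewrite lee_fin.
exists setT; split => //; apply/eqP.
by rewrite eq_le muT measure_ge0.
Qed.

Lemma Lnormy_ae f : ('N[mu]_+oo[EFin \o f] < +oo)%E ->
  {ae mu, forall y, `|f y| <= fine 'N[mu]_+oo[EFin \o f]}.
Proof.
move=> foo; apply/Lnormy_le; first by rewrite fine_ge0// Lnorm_ge0.
by rewrite fineK// ge0_fin_numE// Lnorm_ge0.
Qed.

Lemma ae_eq_Lgauge p f g : (0 < p)%E -> {ae mu, forall y, f y = g y} ->
  Lgauge p f = Lgauge p g.
Proof.
case: p => [r| |] //= _ fg.
  apply: ge0_ae_eq_integralT => [y|y|]; rewrite ?lee_fin ?powR_ge0//.
  by apply: filterS fg => y ->.
rewrite unlock; case: ifP => // _; apply: eq_ess_sup.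
by apply: filterS fg => y /= ->.
Qed.

Lemma Lnorm_lty p f : (0 < p)%E ->
  ('N[mu]_p[EFin \o f] < +oo)%E <-> (Lgauge p f < +oo)%E.
Proof.
case: p => [r| |] // r0; rewrite Lnorm_fin_gauge; split.
  by apply: lty_poweRy; rewrite invr_neq0// gt_eqF.
exact: poweR_lty.
Qed.

(** A quasi-triangle inequality at every exponent. For finite r, |c f + g| is at most 2 max(|c|, 1)
    max(|f|, |g|), and the r-th power of the last maximum is at most |f|^r + |g|^r. *)
Lemma Lgauge_lincomb_le p (c : R) : (0 < p)%E ->
  exists2 K : R, 0 <= K & forall f g : T -> R,
    measurable_fun setT f -> measurable_fun setT g ->
    (Lgauge p (fun y => c * f y + g y)%R <= K%:E * (Lgauge p f + Lgauge p g))%E.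
Proof.
case: p => [r| |] //= p0; last first.
  exists (Num.max `|c| 1); first by rewrite le_max ler01 orbT.
  move=> f g _ _; set K := Num.max _ _.
  have K0 : 0 < K by rewrite lt_max ltr01 orbT.
  have [foo|] := ltP ('N[mu]_+oo[EFin \o f])%E +oo%E; last first.
    rewrite leye_eq => /eqP ->; rewrite addye; last first.
      by rewrite gt_eqF// (lt_le_trans _ (Lnorm_ge0 _ _ _)) ?ltNy0.
    by rewrite gt0_muley ?leey// lte_fin.
  have [goo|] := ltP ('N[mu]_+oo[EFin \o g])%E +oo%E; last first.
    rewrite leye_eq => /eqP ->; rewrite addey; last first.
      by rewrite gt_eqF// (lt_le_trans _ (Lnorm_ge0 _ _ _)) ?ltNy0.
    by rewrite gt0_muley ?leey// lte_fin.
  have f_fin : ('N[mu]_+oo[EFin \o f])%E \is a fin_num by rewrite ge0_fin_numE// Lnorm_ge0.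
  have g_fin : ('N[mu]_+oo[EFin \o g])%E \is a fin_num by rewrite ge0_fin_numE// Lnorm_ge0.
  rewrite -(fineK f_fin) -(fineK g_fin) -EFinD -EFinM.
  apply/Lnormy_le.
    by rewrite mulr_ge0 ?(ltW K0)// addr_ge0// fine_ge0// Lnorm_ge0.
  apply: filterS2 (Lnormy_ae foo) (Lnormy_ae goo) => y fy gy.
  apply: le_trans (ler_normD _ _) _; rewrite mulrDr lerD//.
    by rewrite normrM ler_pM// le_max lexx.
  by apply: le_trans gy _; rewrite ler_peMl ?fine_ge0 ?Lnorm_ge0// le_max lexx orbT.
exists ((2 * Num.max `|c| 1) `^ r); first exact: powR_ge0.
move=> f g mf mg; set K := Num.max _ _.
have K0 : 0 < K by rewrite lt_max ltr01 orbT.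
have mfr := measurable_norm_powR r mf; have mgr := measurable_norm_powR r mg.
rewrite -ge0_integralD//.
have mfgr := emeasurable_funD mfr mgr.
rewrite -ge0_integralZl//; last 2 first.
- by move=> y _; rewrite adde_ge0// lee_fin powR_ge0.
- by rewrite lee_fin powR_ge0.
apply: ge0_ae_le_integralT => [y|y|].
- by rewrite lee_fin powR_ge0.
- by rewrite mule_ge0 ?adde_ge0// lee_fin powR_ge0.
apply/nearW => y; rewrite -EFinD -EFinM lee_fin.
pose a := Num.max `|f y| `|g y|.
have a0 : 0 <= a by rewrite le_max normr_ge0.
have r0 : 0 <= r by exact: ltW.
have le_a : `|c * f y + g y| <= 2 * K * a.
  apply: le_trans (ler_normD _ _) _; rewrite -mulrA mulr_natl mulr2n lerD//.
    by rewrite normrM ler_pM// le_max lexx.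
  apply: (@le_trans _ _ a); first by rewrite le_max lexx orbT.
  by rewrite ler_peMl// le_max lexx orbT.
have K20 : 0 <= 2 * K by rewrite mulr_ge0// ltW.
apply: (@le_trans _ _ ((2 * K * a) `^ r)).
  by apply: ge0_ler_powR => //; rewrite nnegrE; exact: mulr_ge0.
rewrite powRM// ler_wpM2l ?powR_ge0// /a.
by case: (leP `|f y| `|g y|) => _; rewrite ?lerDr ?lerDl powR_ge0.
Qed.

Variable phi : T -> T.
Hypothesis mphi : measurable_fun setT phi.
Hypothesis mu_phi : forall B, measurable B -> mu (phi @^-1` B) = mu B.
Variables (A : T -> R) (Lam : R).
Hypotheses (mA : measurable_fun setT A) (ALam : forall y, `|A y| <= Lam).
Hypotheses (Lam0 : 0 < Lam) (Lam1 : Lam < 1).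

Lemma weighted_composition_solution p : (0 < p)%E ->
  exists2 K : R, 0 <= K & forall v : T -> R, measurable_fun setT v ->
    (Lgauge p v < +oo)%E ->
    exists u : T -> R, [/\ measurable_fun setT u,
      {ae mu, forall y, u y = v y + A y * u (phi y)} &
      (Lgauge p u <= K%:E * Lgauge p v)%E].
Proof.
case: p => [r| |] //= p0.
  by have := weighted_composition_solution_power mphi mu_phi mA ALam Lam0 Lam1 p0.
exists (1 - Lam)^-1; first by rewrite invr_ge0 subr_ge0 ltW.
move=> v mv voo.
have [u [mu_ uE uM]] := weighted_composition_solution_bounded mphi mu_phi mA ALam
  Lam0 Lam1 mv (Lnormy_ae voo).
exists u; split => //.
rewrite -[X in (_ * X)%E]fineK ?ge0_fin_numE ?Lnorm_ge0// -EFinM mulrC.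
apply/Lnormy_le => //.
by rewrite mulr_ge0 ?fine_ge0 ?Lnorm_ge0// invr_ge0 subr_ge0 ltW.
Qed.

Lemma convolution_exists p : (0 < p)%E ->
  exists2 K : R, 0 <= K & forall f b : T -> R,
    measurable_fun setT f -> measurable_fun setT b ->
    (Lgauge p f < +oo)%E -> (Lgauge p b < +oo)%E ->
    exists g : T -> R, [/\ measurable_fun setT g,
      {ae mu, forall y, g y = f y + A y * (g (phi y) - b (phi y))} &
      (Lgauge p g <= K%:E * (Lgauge p f + Lgauge p b))%E].
Proof.
move=> p0; have [K1 K10 solve] := weighted_composition_solution p0.
have [K2 K20 diff] := Lgauge_lincomb_le (-1) p0.
have [K3 K30 sum] := Lgauge_lincomb_le 1 p0.
(* With v = f - b and g = u + b: [K2] bounds v by f and b, [K1] bounds u by v, [K3] bounds g by u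
   and b; the 1 accounts for b itself. *)
exists (K3 * (K1 * K2 + 1)); first by rewrite mulr_ge0// addr_ge0// mulr_ge0.
move=> f b mf mb foo boo.
have mv : measurable_fun setT (fun y => -1 * b y + f y).
  by apply: measurable_funD => //; exact: measurable_funM.
have vle := diff _ _ mb mf.
have [|u [mu_ uE ule]] := solve _ mv.
  apply: le_lt_trans vle _; rewrite -ge0_fin_numE ?mule_ge0 ?adde_ge0 ?Lgauge_ge0 ?lee_fin//.
  by rewrite fin_numM// fin_numD !ge0_fin_numE ?Lgauge_ge0// boo foo.
exists (fun y => 1 * u y + b y); split.
- by apply: measurable_funD => //; exact: measurable_funM.
- apply: filterS uE => y uE; rewrite !mul1r {1}uE; ring.
apply: le_trans (sum _ _ mu_ mb) _; rewrite EFinM -muleA lee_wpmul2l ?lee_fin//.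
rewrite EFinD ge0_muleDl ?lee_fin ?mulr_ge0// mul1e leeD//; last first.
  by rewrite leeDr ?Lgauge_ge0.
apply: le_trans ule _; rewrite EFinM -muleA lee_wpmul2l ?lee_fin//.
by rewrite [X in (_ * X)%E]addeC.
Qed.

Hypothesis muT : (mu setT < +oo)%E.

Lemma convolution_unique p (f b g g' : T -> R) : (0 < p)%E ->
  measurable_fun setT g -> measurable_fun setT g' ->
  (Lgauge p g < +oo)%E -> (Lgauge p g' < +oo)%E ->
  {ae mu, forall y, g y = f y + A y * (g (phi y) - b (phi y))} ->
  {ae mu, forall y, g' y = f y + A y * (g' (phi y) - b (phi y))} ->
  {ae mu, forall y, g y = g' y}.
Proof.
move=> p0 mg mg' goo g'oo gE g'E; have [K K0 diff] := Lgauge_lincomb_le (-1) p0.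
pose h y : R := -1 * g' y + g y.
have mh : measurable_fun setT h.
  by apply: measurable_funD => //; exact: measurable_funM.
have hoo : (Lgauge p h < +oo)%E.
  apply: le_lt_trans (diff _ _ mg' mg) _.
  rewrite -ge0_fin_numE ?mule_ge0 ?adde_ge0 ?Lgauge_ge0 ?lee_fin//.
  by rewrite fin_numM// fin_numD !ge0_fin_numE ?Lgauge_ge0// goo g'oo.
have hE : {ae mu, forall y, h y = A y * h (phi y)}.
  apply: filterS2 gE g'E => y gE g'E; rewrite /h {1}gE {1}g'E.
  by rewrite !mulN1r; ring.
suff : {ae mu, forall y, h y = 0}.
  by apply: filterS => y /eqP; rewrite /h mulN1r addrC subr_eq0 => /eqP.
(* As [mu] is finite, an essentially bounded function is integrable, so p = oo is reduced to
   exponent 1. *)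
have [r r0 roo] : exists2 r : R, 0 < r & (\int[mu]_y (`|h y| `^ r)%:E < +oo)%E.
  case: p p0 hoo {diff goo g'oo} => [r| |] //= p0 hoo; first by exists r.
  exists 1 => //; apply: (@le_lt_trans _ _ (\int[mu]_y (fine 'N[mu]_+oo[EFin \o h])%:E)%E).
    apply: ge0_ae_le_integralT => [y|y|].
    - by rewrite lee_fin powR_ge0.
    - by rewrite lee_fin fine_ge0// Lnorm_ge0.
    by apply: filterS (Lnormy_ae hoo) => y; rewrite lee_fin powRr1.
  rewrite integral_cst// -ge0_fin_numE ?mule_ge0 ?lee_fin ?fine_ge0 ?Lnorm_ge0//.
  by rewrite fin_numM// ge0_fin_numE.
exact: (weighted_composition_fixed_eq0 mphi mu_phi ALam Lam0 Lam1 r0 mh hE roo).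
Qed.

End Lp_gauge.

(** * The fractal convolution as a weighted composition equation *)

Section fractal_convolution.
Context (R : realType) (N : nat) (x : nat -> R) (alpha : nat -> R -> R).
Hypothesis N0 : (0 < N)%N.
Hypothesis xS : forall k : nat, (k < N)%N -> x k < x k.+1.

Local Notation I := (Iset x N).
Local Notation mu := (muI x N).
Local Notation phi := (partition_shift N x).

Lemma muI_setT_lty : (mu setT < +oo)%E.
Proof.
rewrite /muI /= /mrestr setTI /Iset lebesgue_measure_itv /=.
by case: ifP => _; rewrite ?ltry// -EFinD ltry.
Qed.

Lemma measurable_restrict_Iset (f : R -> R) : measurable_fun I f ->
  measurable_fun (setT : set (measurableTypeR R)) (f \_ I).
Proof. by move=> mf; apply/(measurable_restrictT _ (Iset_measurable x N)). Qed.

Lemma restrict_IsetE (f : R -> R) y : I y -> (f \_ I) y = f y.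
Proof. by move=> Iy; rewrite patchE mem_set. Qed.

Lemma ae_restrict_Iset (f : R -> R) : {ae mu, forall y, f y = (f \_ I) y}.
Proof.
by apply: ae_imply (ae_muI_Iset N x) => y Iy; rewrite restrict_IsetE.
Qed.

Lemma inLp_Lgauge p (f : R -> R) : (0 < p)%E ->
  inLp x N p f <-> measurable_fun I f /\ (Lgauge mu p f < +oo)%E.
Proof.
by move=> p0; split=> -[mf ?]; split => //; apply/Lnorm_lty.
Qed.

Lemma inLp_restrict p (f : R -> R) : (0 < p)%E -> inLp x N p f ->
  measurable_fun (setT : set (measurableTypeR R)) (f \_ I) /\
  (Lgauge mu p (f \_ I) < +oo)%E.
Proof.
move=> p0 /(inLp_Lgauge _ p0)[mf foo]; split; first exact: measurable_restrict_Iset.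
by rewrite -(ae_eq_Lgauge p0 (ae_restrict_Iset f)).
Qed.

Lemma inLp_lincomb p (c : R) (f g : R -> R) : (0 < p)%E ->
  inLp x N p f -> inLp x N p g -> inLp x N p (fun z => c * f z + g z).
Proof.
move=> p0 Lf Lg; have [mf foo] := inLp_restrict p0 Lf.
have [mg goo] := inLp_restrict p0 Lg.
apply/(inLp_Lgauge _ p0); split.
  by apply: measurable_funD; [apply: measurable_funM => //; exact: (proj1 Lf)|exact: (proj1 Lg)].
have [K K0 lin] := Lgauge_lincomb_le mu c p0.
have -> : Lgauge mu p (fun z => c * f z + g z) =
    Lgauge mu p (fun y => c * (f \_ I) y + (g \_ I) y).
  apply: ae_eq_Lgauge => //.
  by apply: ae_imply (ae_muI_Iset N x) => y Iy; rewrite !restrict_IsetE.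
apply: le_lt_trans (lin _ _ mf mg) _.
rewrite -ge0_fin_numE ?mule_ge0 ?adde_ge0 ?Lgauge_ge0 ?lee_fin//.
by rewrite fin_numM// fin_numD !ge0_fin_numE ?Lgauge_ge0// foo goo.
Qed.

Lemma fc_eq_lincomb (c : R) (f f' b b' g g' : R -> R) :
  fc_eq x N alpha f b g -> fc_eq x N alpha f' b' g' ->
  fc_eq x N alpha (fun z => c * f z + f' z) (fun z => c * b z + b' z)
    (fun z => c * g z + g' z).
Proof.
apply: ae_imply2 => y gE g'E n nN yn; rewrite (gE n nN yn) (g'E n nN yn); ring.
Qed.

Variable Lam : R.
Hypotheses (Lam0 : 0 < Lam) (Lam1 : Lam < 1).
Hypothesis malpha : forall n, (n < N)%N -> measurable_fun I (alpha n.+1).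
Hypothesis alphaLam : forall n, (n < N)%N ->
  {ae mu, forall y, `|alpha n.+1 y| <= Lam}.

(* alpha_n (L_n^-1 y) on I_n, truncated so that |weight| <= Lam holds
   everywhere instead of almost everywhere. *)
Definition weight (y : R) : R :=
  \sum_(n < N) \1_(Ipiece x n.+1) y *
    Num.max (- Lam) (Num.min Lam ((alpha n.+1 \_ I) (phi y))).

Lemma weight_le y : `|weight y| <= Lam.
Proof.
have [[n nN yn]|nI] := pselect (exists2 n, (n < N)%N & Ipiece x n.+1 y).
  rewrite /weight (sum_IpieceE N0 xS (fun n => Num.max (- Lam) (Num.min Lam ((alpha n.+1 \_ I) (phi y)))) nN yn).
  rewrite ler_norml le_max lexx /= ge_max ge_min lexx /= andbT.
  by rewrite (@le_trans _ _ 0) ?oppr_le0// ltW.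
rewrite /weight big1 ?normr0 ?(ltW Lam0)// => n _.
by rewrite indicE memNset ?mul0r// => yn; apply: nI; exists n.
Qed.

Lemma measurable_weight : measurable_fun (setT : set (measurableTypeR R)) weight.
Proof.
apply: measurable_sum => n; apply: measurable_funM.
  exact: (@measurable_indic _ _ R setT _ (measurable_Ipiece x n.+1)).
apply: measurable_maxr => //; apply: measurable_minr => //.
apply: (measurableT_comp (measurable_restrict_Iset (malpha (ltn_ord n)))).
exact: measurable_partition_shift.
Qed.

Lemma ae_weightE : {ae mu, forall y, forall n, (n < N)%N ->
  Ipiece x n.+1 y -> weight y = alpha n.+1 (phi y)}.
Proof.
have : {ae mu, forall y, forall n, (n < N)%N -> `|alpha n.+1 y| <= Lam}.
  apply: ae_foralln => n; case: (ltnP n N) => [nN|_].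
    by apply: ae_imply (alphaLam nN) => y ay _.
  by apply: ae_imply (ae_muI_Iset N x).
(* The bounds on the scale functions are needed at [phi y]; invariance of the measure transports
   them there. *)
move/(ae_preimage (measurable_partition_shift N x) (muI_partition_shift N0 xS)).
apply: ae_imply => y ay n nN yn; rewrite /weight.
rewrite (sum_IpieceE N0 xS (fun n => Num.max (- Lam) (Num.min Lam ((alpha n.+1 \_ I) (phi y)))) nN yn).
rewrite restrict_IsetE; last exact: partition_shift_I (Ipiece_sub xS nN yn).
have /andP[a1 a2] : - Lam <= alpha n.+1 (phi y) <= Lam by rewrite -ler_norml ay.
by rewrite min_r// max_r.
Qed.

(** Each point of I lies in exactly one piece, and [phi] maps I into itself, so cutting off at I
    alters neither side of the equation on I. *)
Lemma fc_eqP (f b g : R -> R) : fc_eq x N alpha f b g <->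
  {ae mu, forall y, (g \_ I) y =
    (f \_ I) y + weight y * ((g \_ I) (phi y) - (b \_ I) (phi y))}.
Proof.
have aeI : {ae mu, forall y, I y /\ forall n, (n < N)%N ->
    Ipiece x n.+1 y -> weight y = alpha n.+1 (phi y)}.
  by apply: ae_imply2 (ae_muI_Iset N x) ae_weightE => y.
split; apply: ae_imply2 aeI => y [Iy wE] gE.
  rewrite !restrict_IsetE//; last 2 first.
  - exact: partition_shift_I.
  - exact: partition_shift_I.
  have [n nN yn] := Iset_Ipiece N0 xS Iy.
  by rewrite (wE n nN yn) (partition_shiftE N0 xS nN yn); apply: gE; rewrite ?ltnS.
move=> [//|n] nN yn; move: gE; rewrite !restrict_IsetE//; last 2 first.
- exact: partition_shift_I.
- exact: partition_shift_I.
by rewrite (wE n nN yn) (partition_shiftE N0 xS nN yn).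
Qed.

Lemma fc_eq_unique p (f b g g' : R -> R) : (0 < p)%E ->
  inLp x N p g -> inLp x N p g' ->
  fc_eq x N alpha f b g -> fc_eq x N alpha f b g' ->
  {ae mu, forall y, g y = g' y}.
Proof.
move=> p0 /(inLp_restrict p0)[mg goo] /(inLp_restrict p0)[mg' g'oo] /fc_eqP gE /fc_eqP g'E.
have := convolution_unique (measurable_partition_shift N x)
  (muI_partition_shift N0 xS) weight_le Lam0 Lam1 muI_setT_lty p0 mg mg' goo g'oo gE g'E.
by apply: ae_imply2 (ae_muI_Iset N x) => y Iy; rewrite !restrict_IsetE.
Qed.

Lemma fconv_spec p : (0 < p)%E ->
  exists2 K : R, 0 <= K & forall f b : R -> R, inLp x N p f -> inLp x N p b ->
    [/\ inLp x N p (fconv x N p alpha f b),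
      fc_eq x N alpha f b (fconv x N p alpha f b) &
      (Lgauge mu p (fconv x N p alpha f b) <=
        K%:E * (Lgauge mu p f + Lgauge mu p b))%E].
Proof.
move=> p0.
have [K K0 solve] := convolution_exists (measurable_partition_shift N x)
  (muI_partition_shift N0 xS) measurable_weight weight_le Lam0 Lam1 p0.
exists K => // f b Lf Lb.
have [mf foo] := inLp_restrict p0 Lf; have [mb boo] := inLp_restrict p0 Lb.
have [g [mg gE gle]] := solve _ _ mf mb foo boo.
have Lg : inLp x N p g.
  apply/(inLp_Lgauge _ p0); split; first exact: measurable_funTS.
  apply: le_lt_trans gle _.
  rewrite -ge0_fin_numE ?mule_ge0 ?adde_ge0 ?Lgauge_ge0 ?lee_fin//.
  by rewrite fin_numM// fin_numD !ge0_fin_numE ?Lgauge_ge0// foo boo.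
have gfc : fc_eq x N alpha f b g.
  apply/fc_eqP; apply: ae_imply2 (ae_muI_Iset N x) gE => y Iy gE.
  by rewrite !(restrict_IsetE g)//; exact: partition_shift_I.
have [Lh hE] : inLp x N p (fconv x N p alpha f b) /\
    fc_eq x N alpha f b (fconv x N p alpha f b).
  exact: (xgetPex (P := [set h | inLp x N p h /\ fc_eq x N alpha f b h])
    (cst 0) (ex_intro _ g (conj Lg gfc))).
split => //.
(* The estimate holds for the constructed solution [g]; uniqueness passes it to the representative
   chosen by [xget]. *)
rewrite (ae_eq_Lgauge p0 (fc_eq_unique p0 Lh Lg hE gfc)).
by rewrite (ae_eq_Lgauge p0 (ae_restrict_Iset f)) (ae_eq_Lgauge p0 (ae_restrict_Iset b)).
Qed.

End fractal_convolution.

(** * A uniform contraction constant, and the passage from powers to norms *)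

Lemma ess_sup_uniform_lt1 (R : realType) (N : nat) (x : nat -> R)
    (alpha : nat -> R -> R) :
  (forall n, (1 <= n <= N)%N -> ('N[muI x N]_+oo[EFin \o alpha n] < 1)%E) ->
  exists Lam : R, [/\ 0 < Lam, Lam < 1 & forall n, (n < N)%N ->
    {ae muI x N, forall y, `|alpha n.+1 y| <= Lam}].
Proof.
move=> a1; suff [Lam [L0 L1 aL]] : exists Lam : R, [/\ 0 < Lam, Lam < 1 &
    forall n, (n < N)%N -> ('N[muI x N]_+oo[EFin \o alpha n.+1] <= Lam%:E)%E].
  exists Lam; split => // n nN; apply/Lnormy_le; first exact: ltW.
  exact: aL.
suff : forall k, (k <= N)%N -> exists Lam : R, [/\ 0 < Lam, Lam < 1 &
    forall n, (n < k)%N -> ('N[muI x N]_+oo[EFin \o alpha n.+1] <= Lam%:E)%E].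
  by move=> /(_ N (leqnn N)).
elim=> [|k ih] kN.
  (* Starting from 1/2 keeps [Lam] positive even when all scale functions vanish; the positivity of
     [m] in the series estimate rests on it. *)
  by exists 2^-1; split => //; rewrite invf_lt1// ltr1n.
have [Lam [L0 L1 aL]] := ih (ltnW kN).
have ak := a1 k.+1 kN.
have a_fin : ('N[muI x N]_+oo[EFin \o alpha k.+1])%E \is a fin_num.
  by rewrite ge0_fin_numE ?Lnorm_ge0// (lt_trans ak)// ltry.
exists (Num.max Lam (fine 'N[muI x N]_+oo[EFin \o alpha k.+1])); split.
- by rewrite lt_max L0.
- by rewrite gt_max L1 -lte_fin fineK.
move=> n; rewrite ltnS leq_eqVlt => /orP[/eqP ->|nk].
  by rewrite -{1}(fineK a_fin) lee_fin le_max lexx orbT.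
by apply: le_trans (aL n nk) _; rewrite lee_fin le_max lexx.
Qed.

(** F + B is at most twice the maximum, whence the factor 2, and the root of a maximum is at most
    the sum of the roots. *)
Lemma poweR_root_le (R : realType) (K r : R) (F B G : \bar R) :
  0 < r -> 0 <= K -> (0 <= F)%E -> (0 <= B)%E -> (0 <= G)%E ->
  (G <= K%:E * (F + B))%E ->
  (G `^ r^-1 <= ((K * 2) `^ r^-1)%:E * (F `^ r^-1 + B `^ r^-1))%E.
Proof.
move=> r0 K0 F0 B0 G0 le_G; rewrite -poweR_EFin.
have K20 : 0 <= K * 2 by rewrite mulr_ge0.
have le_max2 : (G <= (K * 2)%:E * Order.max F B)%E.
  apply: le_trans le_G _; rewrite EFinM -muleA lee_wpmul2l ?lee_fin//.
  by rewrite mule_natl mule2n leeD// le_max lexx ?orbT.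
apply: (@le_trans _ _ (((K * 2)%:E * Order.max F B) `^ r^-1)%E).
  have max0 : (0 <= (K * 2)%:E * Order.max F B)%E.
    by rewrite mule_ge0 ?lee_fin// le_max F0.
  apply: gt0_ler_poweR => //; first by rewrite invr_ge0 ltW.
    by rewrite in_itv /= leey andbT.
  by rewrite in_itv /= leey andbT.
rewrite poweRM ?lee_fin ?le_max ?F0// lee_wpmul2l ?poweR_ge0//.
by case: (leP F B) => _; rewrite ?leeDr ?leeDl ?poweR_ge0.
Qed.

Unset Implicit Arguments.

Theorem theorem3p3 (R : realType) (N : nat) (x : nat -> R)
  (alpha : nat -> R -> R) (p : \bar R) :
  (2 <= N)%N ->
  (forall k : nat, (k < N)%N -> x k < x k.+1) ->
  (* scale functions alpha_1..alpha_N in L^oo(I), with Lambda < 1 *)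
  (forall n : nat, (1 <= n <= N)%N -> inLp x N +oo%E (alpha n)) ->
  (forall n : nat, (1 <= n <= N)%N -> ('N[muI x N]_+oo[EFin \o alpha n] < 1)%E) ->
  (0 < p)%E ->
  (* linearity of (f, b) |-> f *_T b *)
  (forall (c : R) (f f' b b' : R -> R),
     inLp x N p f -> inLp x N p f' -> inLp x N p b -> inLp x N p b' ->
     {ae muI x N, forall y,
        fconv x N p alpha (fun z => c * f z + f' z) (fun z => c * b z + b' z) y
        = c * fconv x N p alpha f b y + fconv x N p alpha f' b' y}) /\
  (* boundedness *)
  (exists C : R, 0 <= C /\
     forall f b : R -> R, inLp x N p f -> inLp x N p b ->
       if (1 <= p)%E then
         ('N[muI x N]_p[EFin \o fconv x N p alpha f b]
            <= C%:E * ('N[muI x N]_p[EFin \o f] + 'N[muI x N]_p[EFin \o b]))%E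
       else
         (dp0 x N (fine p) (fconv x N p alpha f b)
            <= C%:E * (dp0 x N (fine p) f + dp0 x N (fine p) b))%E).
Proof.
move=> N2 xS La a1 p0; have N0 : (0 < N)%N by exact: ltnW.
have [Lam [Lam0 Lam1 aL]] := ess_sup_uniform_lt1 a1.
have ma n : (n < N)%N -> measurable_fun (Iset x N) (alpha n.+1).
  by move=> nN; have [] := La n.+1 nN.
have [K K0 spec] := fconv_spec N0 xS Lam0 Lam1 ma aL p0.
split=> [c f f' b b' Lf Lf' Lb Lb'|].
  have [L1 E1 _] := spec _ _ Lf Lb; have [L2 E2 _] := spec _ _ Lf' Lb'.
  have [L3 E3 _] := spec _ _ (inLp_lincomb c p0 Lf Lf') (inLp_lincomb c p0 Lb Lb').
  apply: (fc_eq_unique N0 xS Lam0 Lam1 aL p0 L3 (inLp_lincomb c p0 L1 L2) E3).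
  exact: fc_eq_lincomb.
(* For p = oo the gauge is the norm and for p < 1 it is [dp0], so [K] serves directly; for finite p
   >= 1 a root is taken. *)
case: p p0 spec {La} => [r| |] // r0 spec; last first.
  by exists K; split => // f b Lf Lb; rewrite leey; have [] := spec f b Lf Lb.
have r'0 : r != 0 by rewrite gt_eqF.
have [r1|r1] := leP 1%E r%:E; last first.
  by exists K; split => // f b Lf Lb; have [] := spec f b Lf Lb.
exists ((K * 2) `^ r^-1); split=> [|f b Lf Lb]; first exact: powR_ge0.
have [_ _ le_g] := spec f b Lf Lb; rewrite !Lnorm_fin_gauge.
by apply: poweR_root_le; rewrite ?Lgauge_ge0.
Qed.
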